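(* Let $1\le t\le n$ be integers and let $\mathbb{F}$ be a finite field. Let $C$ be an unrestricted arithmetic circuit over $\mathbb{F}$ (arbitrary gates, unbounded fan-in) with $t$ inputs, consisting of the secret $s$ and $t-1$ random field elements $r_1,\dots,r_{t-1}$, and with $n$ outputs, and suppose that $C$ computes the $n$ shares of a $(t,n)$-threshold secret sharing scheme. Then: (1) the underlying directed acyclic graph of $C$ is a $(t,n)$-concentrator; (2) the graph obtained from it by removing the input vertex $s$ (together with its incident edges) is a $(t-1,n)$-concentrator.
   Context: Unrestricted arithmetic circuit over $\mathbb{F}$: a finite directed acyclic graph with designated input vertices (having no incoming edges) and designated output vertices; each non-input vertex (gate) of in-degree $k$ computes an arbitrary function $\mathbb{F}^k\to\mathbb{F}$ of the values of its in-neighbours; $k$ is unbounded. $(t,n)$-concentrator ($t\le n$): a directed acyclic graph with $t$ inputs and $n$ outputs in which for every set $T$ of $t$ outputs there are $t$ pairwise vertex-disjoint directed paths connecting $t$ distinct inputs to the vertices of $T$. Computing the shares of a $(t,n)$-threshold secret sharing scheme: let $S$ (the value at input $s$) be uniform over $\mathbb{F}$, let the values at the random inputs be uniform over $\mathbb{F}$, with all inputs mutually independent, and let $Y_1,\dots,Y_n$ be the values of the $n$ outputs (the shares). For $T\subseteq[n]$ let $Y_T=(Y_i)_{i\in T}$. It is required that $H(S\mid Y_T)=0$ for every $T\subseteq[n]$ with $|T|=t$ (correctness) and $H(S\mid Y_T)=H(S)$ for every $T\subseteq[n]$ with $|T|=t-1$ (privacy), where $H$ is Shannon entropy. *)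

(* Defs.v *)
From HB Require Import structures.
From mathcomp Require Import all_boot all_order all_algebra.
From mathcomp Require Import reals exp.

Set Implicit Arguments.
Unset Strict Implicit.
Unset Printing Implicit Defensive.

Import Order.TTheory GRing.Theory Num.Theory.

Local Open Scope ring_scope.

Section Digraph.
Variable V : finType.
Implicit Types (e : rel V) (D I O T : {set V}).

(* [cycle e [:: x]] is [e x x], so loops are excluded too. *)
Definition acyclic e : Prop := forall c : seq V, cycle e c -> c = [::].

Definition induced D e : rel V := fun u v => [&& u \in D, v \in D & e u v].

(* [p = [::]] is the path of length 0 at [x]. *)
Definition dipath D e (x : V) (p : seq V) : bool :=
  (x \in D) && path (induced D e) x p.

(* The paths are indexed by their final vertices; disjointness forces their
   initial vertices to be distinct. *)
Definition disjointly_linked D e I T : Prop :=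
  exists (src : V -> V) (p : V -> seq V),
    (forall y, y \in T ->
       [/\ src y \in I, dipath D e (src y) (p y) & last (src y) (p y) = y]) /\
    (forall y z, y \in T -> z \in T -> y != z ->
       forall v, v \in src y :: p y -> v \notin src z :: p z).

(* The graph is the subgraph of [e] induced on the vertex set [D], with inputs
   [I] and outputs [O].  For [0 < t] every output lies in some [T], so the last
   condition already forces [O \subset D]; for [t = 0] this is not required:
   when [t = 1] the secret may itself be a share, and deleting its vertex must
   then still leave a (0, n)-concentrator. *)
Definition concentrator (t n : nat) D e I O : Prop :=
  [/\ (t <= n)%N,
      acyclic (induced D e),
      I \subset D /\ #|I| = t,
      #|O| = n &
      forall T, T \subset O -> #|T| = t -> disjointly_linked D e I T].

End Digraph.

(* The circuit has [m] random inputs besides the secret.  A gate of in-degree 0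
   that is not an input is a constant; an output vertex may be an input and may
   have outgoing edges.  The component [gate v] is irrelevant when [v] is an
   input. *)
Record circuit (F : finFieldType) (m n : nat) := Circuit {
  vertex : finType;
  edge : rel vertex;
  secret : vertex;
  random : 'I_m -> vertex;
  output : 'I_n -> vertex;
  gate : forall v : vertex, {ffun {u : vertex | edge u v} -> F} -> F;
  edge_acyclic : acyclic edge;
  random_inj : injective random;
  random_neq_secret : forall j, random j != secret;
  output_inj : injective output;
  secret_source : forall u, ~~ edge u secret;
  random_source : forall u j, ~~ edge u (random j)
}.
Arguments edge {F m n} c _ _.

(* The value of the secret and the values of the [m] random inputs. *)
Notation assignment F m := (F * {ffun 'I_m -> F})%type.

Section Evaluation.
Variables (F : finFieldType) (m n : nat) (C : circuit F m n).
Implicit Types (x : assignment F m) (v : vertex C) (w : vertex C -> F).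

Definition inputs : {set vertex C} := secret C |: [set random C j | j : 'I_m].
Definition outputs : {set vertex C} := [set output C i | i : 'I_n].

Definition input_value x v : option F :=
  if v == secret C then Some x.1
  else omap x.2 [pick j | random C j == v].

Definition eval_step x w v : F :=
  if input_value x v is Some a then a
  else gate [ffun u : {u : vertex C | edge C u v} => w (val u)].

(* By acyclicity the iteration is stationary after [#|vertex C|] rounds, see
   [eval_gate]; the initial values are irrelevant. *)
Definition eval x : vertex C -> F :=
  iter #|vertex C| (eval_step x) (fun=> 0).

Lemma eval_step_changed x w k v :
  iter k.+1 (eval_step x) w v != iter k (eval_step x) w v ->
  exists u p, [/\ path (edge C) u p, last u p = v & size p = k].
Proof.
elim: k v => [|k IHk] v; first by exists v, [::].
rewrite !iterS /eval_step; case: (input_value x v) => [a|]; first by rewrite eqxx.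
case: (pickP [pred u : {u : vertex C | edge C u v} |
   iter k.+1 (eval_step x) w (val u) != iter k (eval_step x) w (val u)]).
  move=> u /= /IHk [u0 [p [pp lp sp]]] _.
  exists u0, (rcons p v); rewrite rcons_path last_rcons size_rcons sp pp lp.
  by split=> //; exact: (valP u).
move=> same /negP[]; apply/eqP; congr gate; apply/ffunP => u; rewrite !ffunE.
by apply/eqP; move/negbFE: (same u).
Qed.

Lemma acyclic_path_size u p :
  path (edge C) u p -> (size p < #|vertex C|)%N.
Proof.
move=> pp; suff uup : uniq (u :: p).
  by rewrite -[X in (X <= _)%N]/(size (u :: p)) -(card_uniqP uup) max_card.
elim: p u pp => [//|y p IHp] u pp /=.
have /= /andP[_ py] := pp; have := IHp y py; rewrite /= => ->; rewrite andbT.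
apply/negP => uyp; case/splitPr: {IHp py} (y :: p) / uyp pp => p1 p2.
rewrite cat_path /= => /and3P[p1u ap _].
have : cycle (edge C) (u :: p1) by rewrite /= rcons_path p1u.
by move/edge_acyclic.
Qed.

Lemma eval_fix x v : eval x v = eval_step x (eval x) v.
Proof.
apply/esym/eqP; rewrite /eval -iterS; apply/negPn/negP => /eval_step_changed.
by case=> u [p [/acyclic_path_size lt_p _ sz_p]]; rewrite sz_p ltnn in lt_p.
Qed.

Lemma eval_secret x : eval x (secret C) = x.1.
Proof. by rewrite eval_fix /eval_step /input_value eqxx. Qed.

Lemma eval_random x j : eval x (random C j) = x.2 j.
Proof.
rewrite eval_fix /eval_step /input_value (negPf (random_neq_secret C j)).
by case: pickP => [i /eqP/random_inj -> //|/(_ j)]; rewrite eqxx.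
Qed.

Lemma eval_gate x v : v \notin inputs ->
  eval x v = gate [ffun u : {u : vertex C | edge C u v} => eval x (val u)].
Proof.
rewrite !inE negb_or => /andP[vs vr]; rewrite {1}eval_fix /eval_step.
rewrite /input_value (negPf vs); case: pickP => [j /eqP vj|//].
by case/negP: vr; rewrite -vj; apply: imset_f.
Qed.

End Evaluation.

Section Entropy.
Variables (R : realType) (W : finType) (P : W -> R).

Definition Pr (E : pred W) : R := \sum_(w | E w) P w.

(* Entropies are in nats.  Terms of probability 0 vanish through the factor in
   front of the logarithm; likewise conditioning on an event of probability 0
   (where division by 0 yields 0) has weight 0. *)
Definition entropy (A : finType) (X : W -> A) : R :=
  - \sum_(a : A) Pr (fun w => X w == a) * ln (Pr (fun w => X w == a)).

Definition cond_Pr (E G : pred W) : R := Pr (fun w => E w && G w) / Pr G.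

Definition cond_entropy (A B : finType) (X : W -> A) (Y : W -> B) : R :=
  \sum_(b : B) Pr (fun w => Y w == b) *
    - \sum_(a : A) cond_Pr (fun w => X w == a) (fun w => Y w == b) *
                   ln (cond_Pr (fun w => X w == a) (fun w => Y w == b)).

End Entropy.

Section SecretSharing.
Variables (R : realType) (F : finFieldType) (m n : nat) (C : circuit F m n).

(* The joint law of mutually independent inputs, each uniform over [F], is the
   product of the uniform marginals. *)
Definition uniform (a : F) : R := #|F|%:R^-1.
Definition input_law (x : assignment F m) : R :=
  uniform x.1 * \prod_(j < m) uniform (x.2 j).

Definition secret_value (x : assignment F m) : F := x.1.

(* [Y_T] *)
Definition shares (T : {set 'I_n}) (x : assignment F m) :
    {ffun {i : 'I_n | i \in T} -> F} :=
  [ffun i => eval x (output C (val i))].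

Definition computes_threshold_scheme (t : nat) : Prop :=
  (forall T : {set 'I_n}, #|T| = t ->
     cond_entropy input_law secret_value (shares T) = 0) /\
  (forall T : {set 'I_n}, #|T| = t.-1 ->
     cond_entropy input_law secret_value (shares T)
     = entropy input_law secret_value).

End SecretSharing.

(* Main.v *)
(* Fix a set [T] of [t] shares. By privacy, when all shares of [T] but one are
   fixed the secret still takes every value, and by correctness distinct secrets
   force distinct values of the remaining share; so this share takes every value,
   and changing one share at a time shows that [Y_T] takes all [#|F| ^ t] values.
   Similarly [t - 1] shares take all values while the secret is fixed. Hence
   fewer than [#|T|] vertices never determine [Y_T], so no such set separates
   the inputs from [T], and the disjoint paths come from Hall's theorem through
   the Ingleton-Piff linkage lemma for acyclic graphs. *)
Require Import Defs.
From HB Require Import structures.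
From mathcomp Require Import all_boot all_order all_algebra.
From mathcomp Require Import reals exp.
From mathcomp Require Import zify lra.

Set Implicit Arguments.
Unset Strict Implicit.
Unset Printing Implicit Defensive.

Import Order.TTheory GRing.Theory Num.Theory.

(** * Hall's marriage theorem, by deleting surplus edges *)

Section Hall.
Variables (V W : finType) (A : {set V}).
Implicit Types (N : V -> {set W}) (X : {set V}).

Definition hall_condition N : bool :=
  [forall X : {set V}, (X \subset A) ==> (#|X| <= #|\bigcup_(v in X) N v|)].

(* If deleting either of two neighbours of [v] violates the condition, on [X1]
   and on [X2], then submodularity of [X |-> #|\bigcup_(v in X) N v|] violates
   it for [N] itself, on [X1 :|: X2] or on [X1 :&: X2 :\ v]. *)
Lemma hall_delete N v w1 w2 :
  hall_condition N -> v \in A -> w1 != w2 ->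
  exists2 w, w \in [set w1; w2] &
    hall_condition (fun u => if u == v then N v :\ w else N u).
Proof.
move=> hN vA w12; pose N' w u := if u == v then N v :\ w else N u.
have [h1|/forallPn[X1]] := boolP (hall_condition (N' w1)).
  by exists w1; rewrite ?set21.
have [h2 _|/forallPn[X2]] := boolP (hall_condition (N' w2)).
  by exists w2; rewrite ?set22.
(* A violating [X] contains [v], since otherwise the deletion leaves its neighbourhood unchanged;
   dropping [v] weakens the strict inequality to [<=]. *)
have split w X : ~~ ((X \subset A) ==> (#|X| <= #|\bigcup_(u in X) N' w u|)) ->
    X :\ v \subset A /\
    #|(\bigcup_(u in X :\ v) N u) :|: (N v :\ w)| <= #|X :\ v|.
  rewrite negb_imply -ltnNge => /andP[XA ltX].
  have [vX|vX] := boolP (v \in X); last first.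
    have : #|X| <= #|\bigcup_(u in X) N u| by have /forallP/(_ X)/implyP := hN; apply.
    rewrite leqNgt => /negP[]; move: ltX; congr (_ < _); congr #|pred_of_set _|.
    apply: eq_bigr => u uX; rewrite /N'; case: eqP => // uv.
    by rewrite -uv uX in vX.
  split=> //; first by apply: subset_trans XA; apply: subsetDl.
  rewrite (cardsD1 v) vX add1n ltnS in ltX; apply: leq_trans ltX.
  apply: subset_leq_card; apply/subUsetP; split.
    apply/bigcupsP => u /setD1P[uv uX]; apply: (bigcup_max u) => //.
    by rewrite /N' (negPf uv).
  by apply: (bigcup_max v) => //; rewrite /N' eqxx.
move=> /split[Y2A le2] /split[Y1A le1].
set Y1 := X1 :\ v in Y1A le1; set Y2 := X2 :\ v in Y2A le2.
have inN X u w : u \in X -> w \in N u -> w \in \bigcup_(u in X) N u.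
  by move=> uX wN; apply/bigcupP; exists u.
set U1 := _ :|: _ in le1; set U2 := _ :|: _ in le2.
(* As [w1 != w2], the two reduced copies of [N v] together cover [N v], so Hall's condition applies
   with [v] included; hence the strict inequality. *)
have leU : #|Y1 :|: Y2| < #|U1 :|: U2|.
  have vY : v \notin Y1 :|: Y2 by rewrite !inE eqxx.
  have : #|v |: (Y1 :|: Y2)| <= #|\bigcup_(u in v |: (Y1 :|: Y2)) N u|.
    have /forallP/(_ (v |: (Y1 :|: Y2)))/implyP := hN; apply.
    by rewrite !subUset sub1set vA Y1A Y2A.
  rewrite cardsU1 vY add1n => /leq_trans; apply; apply: subset_leq_card.
  apply/bigcupsP => u; rewrite !in_setU in_set1 => /or3P[/eqP->|uY|uY]; last 2 first.
  - by apply/subsetP => w wN; rewrite 2!in_setU (inN _ u).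
  - by apply/subsetP => w wN; rewrite in_setU orbC in_setU (inN _ u).
  apply/subsetP => w wN; rewrite !in_setU !in_setD1 wN !andbT.
  by have [->|] := eqVneq w w1; rewrite ?w12 !orbT.
have leI : #|Y1 :&: Y2| <= #|U1 :&: U2|.
  have : #|Y1 :&: Y2| <= #|\bigcup_(u in Y1 :&: Y2) N u|.
    have /forallP/(_ (Y1 :&: Y2))/implyP := hN; apply.
    by apply: subset_trans Y1A; apply: subsetIl.
  move=> /leq_trans; apply; apply: subset_leq_card.
  apply/bigcupsP => u /setIP[u1 u2]; apply/subsetP => w wN.
  by rewrite in_setI !in_setU !(inN _ u).
have := cardsUI Y1 Y2; have := cardsUI U1 U2; lia.
Qed.

(** Deletions by [hall_delete] lower the total degree until every vertex of [A] has at most one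
    neighbour; the condition on singletons and pairs then gives existence and injectivity. [f0]
    fills in the values outside [A]. *)
Lemma hall_marriage N (f0 : V -> W) : hall_condition N ->
  exists f : V -> W, {in A, forall v, f v \in N v} /\ {in A &, injective f}.
Proof.
have [k] := ubnP (\sum_(v in A) #|N v|); elim: k N => // k IHk N ltk hN.
have [/existsP[v /andP[vA /card_gt1P[w1 [w2 [w1N w2N w12]]]]]|] :=
  boolP [exists v, (v \in A) && (1 < #|N v|)].
  have [w w_in hN'] := hall_delete hN vA w12.
  have wN : w \in N v by move: w_in; rewrite !inE => /orP[]/eqP->.
  have [|f [fN' finj]] := IHk _ _ hN'.
    apply: leq_trans (ltk : _ <= k); rewrite [in X in _ < X](bigD1 v) //= (bigD1 v) //=.
    rewrite eqxx -addSn; apply: leq_add; first by rewrite [X in _ < X](cardsD1 w) wN.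
    by apply: leq_sum => u /andP[_ /negPf->].
  exists f; split=> // u uA; have := fN' u uA.
  by case: eqP => // -> /setD1P[].
rewrite negb_exists => /forallP le1.
have hall1 X : X \subset A -> #|X| <= #|\bigcup_(v in X) N v|.
  by have /forallP/(_ X)/implyP := hN.
have N1 v : v \in A -> exists w, N v = [set w].
  move=> vA; apply/cards1P; rewrite eqn_leq.
  have := le1 v; rewrite vA -leqNgt => -> /=.
  by have := hall1 [set v]; rewrite sub1set vA cards1 big_set1 => ->.
have f_ v : exists w, v \in A -> N v = [set w].
  by have [/N1[w Nw]|] := boolP (v \in A); [exists w|exists (f0 v)].
have [f fE] := fin_all_exists f_; exists f; split=> [v vA|u v uA vA fuv].
  by rewrite fE // set11.
apply/eqP/negPn/negP => uv; have := hall1 [set u; v].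
rewrite subUset !sub1set uA vA cards2 uv bigcup_setU !big_set1 !fE // fuv setUid.
by rewrite cards1 => /(_ isT).
Qed.

End Hall.

(** * Induction along the edges of an acyclic graph *)

Section AcyclicGraph.
Variables (V : finType) (e : rel V).
Hypothesis e_acyclic : acyclic e.

(** Passing from [v] to an in-neighbour shrinks the set of vertices from which the current one is
    reachable: [v] leaves it, as otherwise there would be a cycle. *)
Lemma acyclic_ind (P : V -> Prop) :
  (forall v, (forall u, e u v -> P u) -> P v) -> forall v, P v.
Proof.
move=> IH v; have [k] := ubnP #|[set u | connect e u v]|.
elim: k v => // k IHk v ltk; apply: IH => u uv; apply: IHk.
apply: leq_trans (ltk : _ <= k); apply/proper_card/properP; split.
  by apply/subsetP => w; rewrite !inE => /connect_trans; apply; apply: connect1.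
exists v; rewrite inE // ?connect0 //; apply/negP => /connectP[p vp uE].
have : cycle e (v :: p) by rewrite /= rcons_path vp -uE.
by move/e_acyclic.
Qed.

End AcyclicGraph.

(** * Disjoint paths from matchings and from counting values *)

Section Linkage.
Variables (V : finType) (e : rel V) (D I B : {set V}).
Hypotheses (De_acyclic : acyclic (induced D e)) (ID : I \subset D).

(* The bipartite graph of the Ingleton-Piff linkage lemma. *)
Definition link_neighbours v : {set V} :=
  (v |: [set u | induced D e u v]) :\: B.

(* A vertex of [B] is not a value of the matching [f], so it lies in [I] or is
   moved by [f]; by injectivity its [f]-orbit moves backwards along edges until
   it reaches [I], and the orbits of distinct vertices of [B] are disjoint. *)
Lemma disjointly_linked_of_hall :
  hall_condition (~: I) link_neighbours -> disjointly_linked D e I B.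
Proof.
move=> /(hall_marriage id)[f [f_nbr f_inj]].
have f_step v : v \notin I -> f v != v -> induced D e (f v) v.
  move=> vI /negPf fv; have := f_nbr v; rewrite inE vI => /(_ isT).
  by rewrite !inE fv => /andP[_].
have f_notB v : v \notin I -> f v \notin B.
  by move=> vI; have := f_nbr v; rewrite inE vI => /(_ isT) /setDP[].
(* Iteration stops at the first vertex in [I]: only off [I] is [f] known to follow edges and to be
   injective. *)
pose orbit v u := exists2 k, u = iter k f v & forall j, j < k -> iter j f v \notin I.
have orbit_path v : (v \notin I -> f v != v) -> exists s : V * seq V,
    [/\ s.1 \in I, dipath D e s.1 s.2, last s.1 s.2 = v &
        forall u, u \in s.1 :: s.2 -> orbit v u].
  elim/(acyclic_ind De_acyclic): v => v IH fv.
  have [vI|vI] := boolP (v \in I).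
    exists (v, [::]); split=> //=; first by rewrite /dipath (subsetP ID).
    by move=> u; rewrite inE => /eqP->; exists 0.
  have fvv := f_step v vI (fv vI).
  have [fvI|[x p] /= [xI /andP[xD xp] lp orb_p]] := IH (f v) fvv.
    apply: contraNneq (fv vI) => ffv.
    by apply/eqP; apply: f_inj; rewrite ?inE.
  exists (x, rcons p v); split=> //=.
  - by rewrite /dipath xD rcons_path xp lp.
  - by rewrite last_rcons.
  move=> u; rewrite -rcons_cons mem_rcons inE => /predU1P[->|/orb_p[k -> kI]].
    by exists 0.
  exists k.+1; rewrite ?iterSr // => -[//|j]; rewrite ltnS iterSr; exact: kI.
(* Cancelling [f] on both sides leaves either [y = z] or a vertex of [B] as a value of [f] off [I],
   which [f_notB] excludes. *)
have orbit_disj y z v : y \in B -> z \in B -> orbit y v -> orbit z v -> y = z.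
  move=> yB zB [i -> iI] [j ijE jI].
  wlog le_ij : y z i j yB zB iI jI ijE / i <= j.
    by move=> IH; case/orP: (leq_total i j) => /IH h; [apply: h|apply/esym/h].
  elim: i j iI jI ijE le_ij => [|i IHi] [|j] iI jI //=.
    by move=> yE; have := f_notB _ (jI j (ltnSn j)); rewrite -yE yB.
  move=> /f_inj; rewrite !inE iI // jI // ltnS => /(_ isT isT).
  by apply: IHi => k lt_k; [apply: iI | apply: jI]; apply: ltnW.
have s_ y : exists s : V * seq V, y \in B ->
    [/\ s.1 \in I, dipath D e s.1 s.2, last s.1 s.2 = y &
        forall u, u \in s.1 :: s.2 -> orbit y u].
  have [yB|] := boolP (y \in B); last by exists (y, [::]).
  case: (orbit_path y) => [yI|s hs]; last by exists s.
  by apply: contraTneq yB => <-; apply: f_notB.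
have [s sP] := fin_all_exists s_.
exists (fun y => (s y).1), (fun y => (s y).2); split=> [y /sP[]//|].
move=> y z yB zB yz v /(let: And4 _ _ _ h := sP y yB in h v) yv.
apply: contra_neqN yz => /(let: And4 _ _ _ h := sP z zB in h v) zv.
exact: orbit_disj yv zv.
Qed.

Variables (F : finType) (W : Type) (val : W -> V -> F) (Q : W -> Prop).
Hypothesis F_gt1 : 1 < #|F|.
Hypothesis val_local : forall x x' v, Q x -> Q x' -> v \notin I ->
  (forall u, induced D e u v -> val x u = val x' u) -> val x v = val x' v.
Hypothesis val_surj : forall y : V -> F, exists2 x, Q x & {in B, val x =1 y}.

(* If [X] violated Hall's condition, its boundary together with [B :\: X] would
   have fewer than [#|B|] vertices, while the values there determine those on
   [X] and hence on [B]. *)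
Lemma disjointly_linked_of_surjective : disjointly_linked D e I B.
Proof.
apply/disjointly_linked_of_hall/forallP => X; apply/implyP => XI.
set N := \bigcup_(v in X) _; rewrite leqNgt; apply/negP => ltN.
pose K := (N :\: X) :|: (B :\: X).
have ltK : #|K| < #|B|.
  (* Each vertex of [X :\: B] is its own neighbour, so [N :&: X] has at least [#|X :\: B|] elements;
     with [ltN] this makes [K] smaller than [B]. *)
  have XBN : X :\: B \subset N.
    apply/subsetP => v /setDP[vX vB]; apply/bigcupP; exists v => //.
    by rewrite !inE vB eqxx.
  have := cardsU (N :\: X) (B :\: X); rewrite -/K.
  have := cardsID B X; have := cardsID X B; have := cardsID X N.
  have := subset_leq_card (_ : X :\: B \subset N :&: X).
  rewrite subsetI XBN subsetDl setIC => /(_ isT).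
  move: ltN; rewrite (setIC B X); lia.
have determ x x' : Q x -> Q x' -> {in K, val x =1 val x'} ->
    forall v, v \in X -> val x v = val x' v.
  move=> Qx Qx' eqK; elim/(acyclic_ind De_acyclic) => v IH vX.
  have vI : v \notin I by have := subsetP XI v vX; rewrite inE.
  apply: val_local => // u uv.
  have [uX|uX] := boolP (u \in X); first exact: IH.
  apply: eqK; rewrite !inE uX /=; have [_|uB] := boolP (u \in B); rewrite ?orbT //.
  by rewrite orbF; apply/bigcupP; exists v => //; rewrite !inE uB uv orbT.
have [a0 _] : exists a : F, a \in F by apply/card_gt0P; apply: ltnW.
have g_ (y : {ffun V -> F}) : exists x, Q x /\ {in B, val x =1 y}.
  by have [x] := val_surj y; exists x.
have [g gP] := fin_all_exists g_.
(* Padding with [a0] represents functions on [B] and on [K] as functions on [V]; injectivity of [h]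
   then gives [#|F| ^ #|B| <= #|F| ^ #|K|]. *)
pose h y := [ffun v => if v \in K then val (g y) v else a0].
pose S := pffun_on a0 (mem B) (mem F).
have h_inj : {in S &, injective h}.
  move=> y z yS zS /ffunP hyz; apply/ffunP => v.
  have [vB|vB] := boolP (v \in B); last first.
    have supp t : t \in S -> t v = a0.
      move=> /pffun_onP[/supportP/(_ v) + _]; exact.
    by rewrite !supp.
  have [[Qy <- //] [Qz <- //]] := (gP y, gP z).
  have eqK : {in K, val (g y) =1 val (g z)}.
    by move=> u uK; have := hyz u; rewrite !ffunE uK.
  have [vX|vX] := boolP (v \in X); first exact: determ.
  by apply: eqK; rewrite !inE vX vB orbT.
have : #|S| <= #|pffun_on a0 (mem K) (mem F)|.
  rewrite -(card_in_imset h_inj); apply: subset_leq_card.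
  apply/subsetP => _ /imsetP[y _ ->]; apply/pffun_onP; split=> //.
  by apply/supportP => v vK; rewrite ffunE (negPf vK).
by rewrite !card_pffun_on leq_exp2l // leqNgt ltK.
Qed.

End Linkage.

Lemma sum_constant (R : nzRingType) (A : finType) (x : R) :
  (\sum_(a : A) x = x * #|A|%:R)%R.
Proof. by rewrite sumr_const mulr_natr. Qed.

(** * Extremal values of conditional entropy *)

Section EntropyBounds.
Local Open Scope ring_scope.
Variables (R : realType) (W : finType) (P : W -> R).
Hypothesis P_gt0 : forall w, 0 < P w.

Lemma Pr_ge0 (E : pred W) : 0 <= Pr P E.
Proof. by apply: sumr_ge0 => w _; apply/ltW. Qed.

Lemma Pr_gt0 (E : pred W) w : E w -> 0 < Pr P E.
Proof.
move=> Ew; rewrite /Pr (bigD1 w) //= ltr_pwDl //.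
by apply: sumr_ge0 => u _; apply/ltW.
Qed.

Lemma Pr_sum (A : finType) (X : W -> A) (G : pred W) :
  \sum_a Pr P (fun w => (X w == a) && G w) = Pr P G.
Proof.
rewrite /Pr (partition_big X xpredT) //=; apply: eq_bigr => a _.
by apply: eq_bigl => w; rewrite andbC.
Qed.

Lemma cond_Pr_sum (A : finType) (X : W -> A) (G : pred W) w : G w ->
  \sum_a cond_Pr P (fun w => X w == a) G = 1.
Proof. by move=> Gw; rewrite -mulr_suml Pr_sum divff // gt_eqF // (Pr_gt0 Gw). Qed.

Lemma cond_Pr_ge0 (E G : pred W) : 0 <= cond_Pr P E G.
Proof. by rewrite divr_ge0 ?Pr_ge0. Qed.

Lemma cond_Pr_gt0 (E G : pred W) w : E w -> G w -> 0 < cond_Pr P E G.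
Proof.
move=> Ew Gw; rewrite divr_gt0 ?(Pr_gt0 Gw) //.
by apply: (@Pr_gt0 _ w); rewrite Ew Gw.
Qed.

Lemma cond_Pr_le1 (E G : pred W) : cond_Pr P E G <= 1.
Proof.
have [w Gw|G0] := pickP G; last first.
  by rewrite /cond_Pr [Pr P G]big_pred0 // invr0 mulr0.
rewrite ler_pdivrMr ?(Pr_gt0 Gw) // mul1r /Pr [leRHS](bigID E) /=.
under eq_bigl do rewrite andbC.
by rewrite lerDl; apply: (Pr_ge0 (fun w => G w && ~~ E w)).
Qed.

Lemma entropy_term_ge0 (x : R) : x <= 1 -> 0 <= - (x * ln x).
Proof.
(* [ln] takes the default value 0 at nonpositive arguments. *)
move=> x1; rewrite oppr_ge0; have [x0|x0] := lerP x 0; first by rewrite ln0 ?mulr0.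
by rewrite mulr_ge0_le0 ?ln_le0 // ltW.
Qed.

(** All summands are nonnegative, so each vanishes and every positive conditional probability is 1;
    two values of [X] for the same [Y] would have total probability at least 2. *)
Lemma cond_entropy_eq0 (A B : finType) (X : W -> A) (Y : W -> B) :
  cond_entropy P X Y = 0 -> forall w w', Y w = Y w' -> X w = X w'.
Proof.
pose c b a := cond_Pr P (fun u => X u == a) (fun u => Y u == b).
have term_ge0 b a : 0 <= - (c b a * ln (c b a)).
  exact/entropy_term_ge0/cond_Pr_le1.
have sum_ge0 b : 0 <= - \sum_a c b a * ln (c b a).
  by rewrite -sumrN; apply: sumr_ge0.
move=> /psumr_eq0P-/(_ (fun b _ => mulr_ge0 (Pr_ge0 _) (sum_ge0 b))) H0 w w' Yww'.
have /eqP := H0 (Y w) isT; rewrite mulf_eq0 gt_eqF ?(@Pr_gt0 _ w) //= -sumrN.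
move=> /eqP/psumr_eq0P-/(_ (fun a _ => term_ge0 _ a)) c_ln.
have c1 u : Y u = Y w -> c (Y w) (X u) = 1.
  move=> Yu; have c0 : 0 < c (Y w) (X u) by apply: (@cond_Pr_gt0 _ _ u); rewrite ?Yu.
  have /eqP := c_ln (X u) isT; rewrite oppr_eq0 mulf_eq0 gt_eqF //=.
  by rewrite ln_eq0 // => /eqP.
apply/eqP/negPn/negP => Xww'.
have : \sum_a c (Y w) a = 1 by apply: (@cond_Pr_sum _ _ _ w).
rewrite (bigD1 (X w)) //= (bigD1 (X w')) 1?eq_sym //= !c1 //.
have : 0 <= \sum_(a | (a != X w) && (a != X w')) c (Y w) a.
  by apply: sumr_ge0 => a _; apply: cond_Pr_ge0.
lra.
Qed.

(* Summand by summand, from [ln y <= y - 1] at [y = (p a * #|A|)^-1]. *)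
Lemma distr_entropy_le (A : finType) (p : A -> R) :
  (forall a, 0 <= p a) -> \sum_a p a = 1 ->
  - (\sum_a p a * ln (p a)) + #|[set a | p a == 0]|%:R / #|A|%:R <= ln #|A|%:R.
Proof.
move=> p_ge0 p_sum; have A_gt0 : 0 < #|A|%:R :> R.
  rewrite ltr0n lt0n; apply: contra_eq_neq p_sum => A0.
  by rewrite big_pred0 ?(eq_sym 0) ?oner_eq0 //; apply: card0_eq.
have -> : #|[set a | p a == 0]|%:R / #|A|%:R
    = \sum_a (p a == 0)%:R / #|A|%:R :> R.
  by rewrite -mulr_suml -sum1dep_card natr_sum big_mkcond; congr (_ * _);
     apply: eq_bigr => a _; case: (p a == 0).
(* The corrections [#|A|%:R^-1 - p a] sum to 0 and make the inequality hold term by term. *)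
have -> : ln #|A|%:R = \sum_a (p a * ln #|A|%:R + #|A|%:R^-1 - p a) :> R.
  rewrite sumrB big_split /= -mulr_suml p_sum mul1r sum_constant.
  by rewrite mulVf ?gt_eqF // addrK.
rewrite -sumrN -big_split; apply: ler_sum => a _ /=.
have [->|pa0] := eqVneq (p a) 0; first by rewrite !mul0r oppr0 !add0r addr0 mul1r.
have pa_gt0 : 0 < p a by rewrite lt_def pa0 p_ge0.
rewrite mul0r addr0 -subr_ge0.
have := @le_ln1Dx R ((p a * #|A|%:R)^-1 - 1).
rewrite ltrBDr addNr invr_gt0 mulr_gt0 // => /(_ isT).
rewrite [1 + _]addrC subrK lnV ?posrE ?mulr_gt0 // lnM ?posrE // => le_ln.
have := ler_wpM2l (ltW pa_gt0) le_ln.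
rewrite mulrBr mulr1 invfM mulrA divff // mul1r.
lra.
Qed.

(** Being an average, the conditional entropy is maximal only if it is so given each occurring value
    of [Y]; the count of null atoms in [distr_entropy_le] is then 0, so each [a] is attained. *)
Lemma cond_entropy_max (A B : finType) (X : W -> A) (Y : W -> B) :
  \sum_w P w = 1 -> cond_entropy P X Y = ln #|A|%:R ->
  forall w a, exists2 w', Y w' = Y w & X w' = a.
Proof.
move=> P1 Hmax w a; pose c b a := cond_Pr P (fun u => X u == a) (fun u => Y u == b).
pose H b : R := - \sum_a c b a * ln (c b a).
have Hle u : H (Y u) + #|[set a | c (Y u) a == 0]|%:R / #|A|%:R <= ln #|A|%:R.
  apply: distr_entropy_le => [a'|]; first exact: cond_Pr_ge0.
  exact: (@cond_Pr_sum _ _ _ u).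
have PrY : \sum_b Pr P (fun u => Y u == b) = 1.
  rewrite -P1 -[RHS]/(Pr P xpredT) -(Pr_sum Y).
  by apply: eq_bigr => b _; apply: eq_bigl => u; rewrite andbT.
have gap_ge0 b : 0 <= Pr P (fun u => Y u == b) * (ln #|A|%:R - H b).
  have [u /eqP <-|Yb] := pickP (fun u => Y u == b); last first.
    by rewrite /Pr big_pred0 // mul0r.
  rewrite mulr_ge0 ?Pr_ge0 // subr_ge0; apply: le_trans (Hle u).
  by rewrite lerDl divr_ge0.
have : \sum_b Pr P (fun u => Y u == b) * (ln #|A|%:R - H b) = 0.
  under eq_bigr do rewrite mulrBr.
  by rewrite sumrB -mulr_suml PrY mul1r -Hmax subrr.
move=> /psumr_eq0P-/(_ (fun b _ => gap_ge0 b) (Y w) isT)/eqP.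
rewrite mulf_eq0 gt_eqF ?(@Pr_gt0 _ w) //= subr_eq0 => /eqP HYw.
have := Hle w; rewrite -HYw gerDl.
have A_gt0 : 0 < #|A|%:R :> R by rewrite ltr0n; apply/card_gt0P; exists a.
rewrite pmulr_lle0 ?invr_gt0 // lern0 => /eqP/cards0_eq/setP/(_ a).
rewrite !inE => ca0; have [u /andP[/eqP Xu /eqP Yu]|none] :=
  pickP (fun u => (X u == a) && (Y u == Y w)); first by exists u.
by move/negP: ca0 => []; rewrite /c /cond_Pr [X in X / _]big_pred0 // mul0r.
Qed.

End EntropyBounds.

(** * Combinatorial consequences of correctness and privacy *)

Section Shares.
Variables (R : realType) (F : finFieldType) (m n t : nat) (C : circuit F m n).
Hypothesis t_gt0 : 0 < t.
Hypothesis C_scheme : computes_threshold_scheme R C t.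
Implicit Types (x : assignment F m) (T : {set 'I_n}) (i : 'I_n).

Local Notation law := (@input_law R F m).
Local Notation share x i := (eval x (output C i)).

Lemma cardF_gt0 : (0 < #|F|%:R :> R)%R.
Proof. by rewrite ltr0n; apply/ltnW/card_finNzRing_gt1. Qed.

Lemma cardF_neq0 : (#|F|%:R != 0 :> R)%R.
Proof. exact/lt0r_neq0/cardF_gt0. Qed.

Lemma input_law_gt0 x : (0 < input_law R x)%R.
Proof.
have u_gt0 (a : F) : (0 < uniform R a :> R)%R.
  by rewrite invr_gt0 cardF_gt0.
by rewrite mulr_gt0 // prodr_gt0.
Qed.

Lemma Pr_secret (a : F) :
  Pr law (fun x : assignment F m => secret_value x == a) = (#|F|%:R^-1)%R.
Proof.
transitivity (\sum_(s | s == a) \sum_(r : {ffun 'I_m -> F}) law (s, r))%R.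
  by rewrite pair_big_dep /=; apply: eq_big => -[s r]; rewrite //= andbT.
rewrite big_pred1_eq.
rewrite /input_law /= /uniform -mulr_sumr prodr_const card_ord sum_constant.
rewrite card_ffun card_ord natrX -exprMn mulVf ?cardF_neq0 //.
by rewrite expr1n mulr1.
Qed.

Lemma input_law_sum : (\sum_x law x = 1)%R.
Proof.
rewrite (partition_big (@secret_value F m) xpredT) //=.
rewrite (eq_bigr (fun=> #|F|%:R^-1)%R) => [|a _]; last exact: Pr_secret.
by rewrite sum_constant mulVf ?cardF_neq0.
Qed.

Lemma entropy_secret :
  entropy law (@secret_value F m) = ln (#|F|%:R : R)%R.
Proof.
rewrite /entropy; under eq_bigr do rewrite Pr_secret.
rewrite sum_constant lnV ?posrE ?cardF_gt0 //.
by rewrite mulrN mulNr opprK mulrAC mulVf ?mul1r ?cardF_neq0.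
Qed.

Lemma sharesP T x x' :
  shares C T x = shares C T x' <-> {in T, forall i, share x i = share x' i}.
Proof.
split=> [/ffunP eqY i iT|eqY]; first by have := eqY (Sub i iT); rewrite !ffunE.
by apply/ffunP => i; rewrite !ffunE eqY ?(valP i).
Qed.

Lemma scheme_correct T x x' : #|T| = t ->
  {in T, forall i, share x i = share x' i} -> x.1 = x'.1.
Proof.
case: C_scheme => [correct _] /correct/(cond_entropy_eq0 input_law_gt0) h.
by move=> /sharesP/h.
Qed.

Lemma scheme_private T x (s : F) : #|T| = t.-1 ->
  exists2 x', x'.1 = s & {in T, forall i, share x' i = share x i}.
Proof.
case: C_scheme => [_ private] /private; rewrite entropy_secret.
move=> /(cond_entropy_max input_law_gt0 input_law_sum)/(_ x s)[x' /sharesP].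
by exists x'.
Qed.

(* As the secret varies with the other [t - 1] shares fixed, the remaining share
   takes distinct values, hence all values. *)
Lemma change_share T x i (a : F) : #|T| = t -> i \in T ->
  exists2 x', share x' i = a & {in T :\ i, forall j, share x' j = share x j}.
Proof.
move=> Tt iT; have T't : #|T :\ i| = t.-1 by rewrite -Tt (cardsD1 i T) iT.
have /fin_all_exists[g gP] s : exists x', x'.1 = s /\
    {in T :\ i, forall j, share x' j = share x j}.
  by have [x'] := scheme_private x s T't; exists x'.
have g_inj : injective (fun s => share (g s) i).
  move=> s s' ss'; have [gs1 gs] := gP s; have [gs'1 gs'] := gP s'.
  rewrite -gs1 -gs'1; apply: (scheme_correct Tt) => j jT; have [->//|ji] := eqVneq j i.
  by rewrite gs ?gs' // !inE ji.
have [h _ hK] := injF_bij g_inj.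
by exists (g (h a)); [exact: hK | have [] := gP (h a)].
Qed.

(** The shares are corrected one by one; [change_share] preserves the other shares of [T], in
    particular those already corrected. *)
Lemma shares_surjective T (y : 'I_n -> F) : #|T| = t ->
  exists x, {in T, forall i, share x i = y i}.
Proof.
move=> Tt; suff [x xP] : exists x, {in enum T, forall i, share x i = y i}.
  by exists x => i iT; apply: xP; rewrite mem_enum.
have : {subset enum T <= T} by move=> i; rewrite mem_enum.
elim: (enum T) => [_|i l IHl lT]; first by exists (0%R, [ffun=> 0%R]).
have [|x xl] := IHl; first by move=> j jl; apply: lT; rewrite inE jl orbT.
have [x' x'i x'T] := change_share x (y i) Tt (lT i (mem_head i l)).
exists x' => j; rewrite inE; have [->//|ji /= jl] := eqVneq j i.
by rewrite x'T ?xl // !inE ji lT // inE jl orbT.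
Qed.

(** As [t.-1 < n], one more share extends [T] to size [t], where [y] is attained; privacy then moves
    the secret to [s] and keeps the shares of [T]. *)
Lemma shares_surjective_fixed_secret T (s : F) (y : 'I_n -> F) :
  t <= n -> #|T| = t.-1 ->
  exists2 x, x.1 = s & {in T, forall i, share x i = y i}.
Proof.
move=> tn Tt; have [i iT] : exists i, i \in ~: T.
  apply/card_gt0P; rewrite cardsCs setCK card_ord Tt subn_gt0.
  by rewrite prednK.
have [|x xT] := @shares_surjective (i |: T) y.
  by rewrite cardsU1 Tt -(prednK t_gt0); move: iT; rewrite inE => ->.
have [x' x's x'T] := scheme_private x s Tt.
by exists x' => // j jT; rewrite x'T // xT // inE jT orbT.
Qed.

End Shares.

(** * The circuit graph and the two concentrators *)

Lemma acyclic_induced (V : finType) (D : {set V}) (e : rel V) :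
  acyclic e -> acyclic (induced D e).
Proof.
by move=> e_acyclic c De_c; apply: e_acyclic; apply: sub_cycle De_c => u v /and3P[].
Qed.

Section CircuitGraph.
Variables (F : finFieldType) (m n : nat) (C : circuit F m n).

Lemma eval_local x x' (v : vertex C) : v \notin inputs C ->
  (forall u, edge C u v -> eval x u = eval x' u) -> eval x v = eval x' v.
Proof.
move=> vI eq_u; rewrite !eval_gate //; congr gate; apply/ffunP => u.
by rewrite !ffunE eq_u ?(valP u).
Qed.

Lemma secret_notin_random : secret C \notin [set random C j | j : 'I_m].
Proof. by apply/imsetP => -[j _ /esym/eqP]; apply/negP/random_neq_secret. Qed.

Lemma card_inputs : #|inputs C| = m.+1.
Proof.
rewrite cardsU1 secret_notin_random card_imset ?card_ord //.
exact: random_inj.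
Qed.

Lemma card_outputs : #|outputs C| = n.
Proof. by rewrite card_imset ?card_ord //; apply: output_inj. Qed.

Lemma outputs_sub (T : {set vertex C}) : T \subset outputs C ->
  exists2 T' : {set 'I_n}, T = [set output C i | i in T'] & #|T'| = #|T|.
Proof.
move=> TO; have TE : T = [set output C i | i in output C @^-1: T].
  apply/setP => v; apply/idP/imsetP => [vT|[i]]; last by rewrite inE => iT ->.
  by have /imsetP[i _ vE] := subsetP TO v vT; exists i; rewrite // inE -vE.
exists (output C @^-1: T) => //.
by rewrite [in RHS]TE card_imset //; apply: output_inj.
Qed.

End CircuitGraph.

Theorem theorem1 (R : realType) (F : finFieldType) (t n : nat)
    (t_gt0 : (1 <= t)%N) (t_le_n : (t <= n)%N)
    (C : circuit F t.-1 n)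
    (C_scheme : computes_threshold_scheme R C t) :
  concentrator t n [set: vertex C] (edge C) (inputs C) (outputs C) /\
  concentrator t.-1 n (~: [set secret C]) (edge C)
    (inputs C :\ secret C) (outputs C).
Proof.
have F_gt1 := card_finNzRing_gt1 F.
have De_acyclic D := acyclic_induced (D := D) (@edge_acyclic _ _ _ C).
have cardI := card_inputs C; rewrite prednK // in cardI.
split; split=> //; rewrite ?card_outputs ?(leq_trans (leq_pred t)) //.
- move=> T /outputs_sub[T' -> T'T] Tt; rewrite -T'T in Tt.
  apply: (@disjointly_linked_of_surjective _ _ _ _ _ _ _ F _
    (@eval _ _ _ C) (fun=> True)) => //.
  + move=> x x' v _ _ vI eq_u; apply: eval_local => // u uv.
    by apply: eq_u; rewrite /induced !inE.
  + move=> y; have [x xP] :=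
      shares_surjective C_scheme (fun i => y (output C i)) Tt.
    by exists x => // _ /imsetP[i iT ->]; apply: xP.
- split; first by apply/subsetP => v; rewrite !inE => /andP[].
  by have /= := congr1 predn cardI; rewrite (cardsD1 (secret C)) setU11.
move=> T /outputs_sub[T' -> T'T] Tt; rewrite -T'T in Tt.
apply: (@disjointly_linked_of_surjective _ _ _ _ _ _ _ F _
  (@eval _ _ _ C) (fun x => x.1 = 0%R)) => //.
- by apply/subsetP => v; rewrite !inE => /andP[].
(* The secret vertex is no longer an input and its edges are gone; its value, fixed to 0, agrees
   under [x] and [x'] both when it is [v] and when it feeds [v]. *)
- move=> x x' v x0 x'0; have [->|vs] := eqVneq v (secret C).
    by rewrite !eval_secret x0 x'0.
  rewrite in_setD1 vs => vI eq_u; apply: eval_local => // u uv.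
  have [->|us] := eqVneq u (secret C); first by rewrite !eval_secret x0 x'0.
  by apply: eq_u; rewrite /induced !inE us vs.
- move=> y; have [x x0 xP] := shares_surjective_fixed_secret t_gt0 C_scheme 0%R
    (fun i => y (output C i)) t_le_n Tt.
  by exists x => // _ /imsetP[i iT ->]; apply: xP.
Qed.
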